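(* Let $V$ be a $b$-complete idempotent semimodule over a $b$-complete idempotent semiring $K$. Then $V$ is isomorphic to a functional $b$-semimodule for which the kernel theorem holds if and only if the identity mapping on $V$ is a $b$-nuclear operator, i.e. (equivalently) $V$ is a $b$-nuclear semimodule.
   Context: An idempotent semigroup is a commutative semigroup $(S,\oplus)$ with $x\oplus x=x$ for all $x$. It carries the standard order $x\preceq y \iff x\oplus y=y$, so $x\oplus y=\sup\{x,y\}$; write $\oplus X=\sup X$ when it exists. ''Bounded'' means bounded from above. $S$ is $b$-complete if every bounded subset, including $\varnothing$, has a least upper bound; then $\mathbf 0=\oplus\varnothing$ is the zero (least) element. An idempotent semiring $K$ is an idempotent semigroup with an associative (not necessarily commutative) multiplication $\odot$ with identity $\mathbf 1$ and both distributive laws; it is $b$-complete if it is a $b$-complete semigroup and $k\odot(\oplus Q)=\oplus(k\odot Q)$, $(\oplus Q)\odot k=\oplus(Q\odot k)$ for all $k\in K$ and bounded $Q\subset K$. A (left, idempotent) semimodule $V$ over $K$ is an idempotent semigroup with zero $\mathbf 0$ and a multiplication $k\odot x$ ($k\in K$, $x\in V$) with $a\odot(b\odot x)=(a\odot b)\odot x$, $(a\oplus b)\odot x=a\odot x\oplus b\odot x$, $a\odot(x\oplus y)=a\odot x\oplus a\odot y$, $\mathbf 0\odot x=\mathbf 0$, $\mathbf 1\odot x=x$. $V$ (over $b$-complete $K$) is $b$-complete if it is a $b$-complete semigroup and $k\odot\oplus S=\oplus(k\odot S)$, $(\oplus Q)\odot v=\oplus(Q\odot v)$ for all $k\in K$,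 $v\in V$ and bounded $S\subset V$, $Q\subset K$. A homomorphism $g:V\to W$ of $b$-complete semimodules (additive, $g(a\odot x)=a\odot g(x)$) is $b$-linear if $g(\oplus S)=\oplus g(S)$ for every bounded $S\subset V$; a $b$-linear functional is a $b$-linear map $V\to K$. $L_b(V,W)$ is the idempotent semigroup of all $b$-linear maps $V\to W$ under pointwise addition. For a nonempty set $X$, $K(X)$ is the semimodule of all functions $X\to K$ with pointwise operations. A functional $b$-semimodule on $X$ is a $b$-subsemimodule $U$ of $K(X)$: a subsemimodule (closed under pointwise addition and scalar multiplication) that is itself $b$-complete and whose inclusion is $b$-linear, i.e. suprema in $U$ of subsets bounded in $U$ are the pointwise suprema. The kernel theorem holds for $U$ if for every $b$-complete semimodule $W$ over $K$ and every $b$-linear mapping $A:U\to W$ there is a mapping $k:X\to W$ such that for every $f\in U$ the set $\{f(x)\odot k(x)\mid x\in X\}$ is bounded in $W$ and $Af=\bigoplus_{x\in X}f(x)\odot k(x)$. A mapping $V\to W$ of $b$-complete semimodules is one-dimensional if it is of the form $v\mapsto\phi(v)\odot w$ with $\phi$ a $b$-linear functional on $V$ and $w\in W$; a mapping $V\to W$ is $b$-nuclear if it is the sum (supremum) in $L_b(V,W)$ of a bounded set of one-dimensional mappings. $V$ is a $b$-nuclear semimodule if every $b$-linear mapping of $V$ to an arbitrary $b$-complete semimodule over $K$ is $b$-nuclear. *)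

(* Defs.v *)
From HB Require Import structures.
From mathcomp Require Export all_boot all_order all_algebra.
From mathcomp Require Export mathcomp_extra boolp classical_sets functions.

Set Implicit Arguments.
Unset Strict Implicit.
Unset Printing Implicit Defensive.

Export GRing.Theory.
Local Open Scope classical_set_scope.
Local Open Scope ring_scope.

(* The idempotent addition is written +, its zero 0, the multiplication
   of K is *, and the action of K on a semimodule is *: .  Semirings and
   semimodules are the (possibly noncommutative, possibly trivial)
   pzSemiRingType and lSemiModType of MathComp; idempotency and b-completeness
   are predicates on them.  For b-complete objects the laws 0 = sum of the
   empty set, 0 * k = k * 0 = 0 and k *: 0 = 0, which are built into
   these structures or derivable in them, are the empty-set instances of the
   axioms below, so these structures impose nothing extra. *)

Section StandardOrder.
Variable T : nmodType.
Implicit Types (x y s : T) (D A : set T).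

Definition idem_le x y : Prop := x + y = y.

Definition upper_bounds A : set T := [set y | forall x, A x -> idem_le x y].

Definition bounded A : Prop := upper_bounds A !=set0.

(* s is the sum of A formed in the subsemigroup D, i.e. its least upper bound
   among the elements of D; in particular A is then bounded in D. *)
Definition is_sum_in D A s : Prop :=
  [/\ D s, upper_bounds A s & forall t, D t -> upper_bounds A t -> idem_le s t].

Definition is_sum A s : Prop := is_sum_in setT A s.

End StandardOrder.

Definition b_complete_semigroup (T : nmodType) : Prop :=
  (forall x : T, x + x = x) /\
  (forall A : set T, bounded A -> exists s, is_sum A s).

(* In a b-complete semigroup the bounded sets are exactly those which have a
   sum, so "for all bounded Q" is expressed as "for all Q with sum q". *)
Definition b_complete_semiring (K : pzSemiRingType) : Prop :=
  [/\ b_complete_semigroup K,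
      forall (k : K) (Q : set K) (q : K),
        is_sum Q q -> is_sum [set k * x | x in Q] (k * q)
    & forall (k : K) (Q : set K) (q : K),
        is_sum Q q -> is_sum [set x * k | x in Q] (q * k)].

Section Semimodules.
Variable K : pzSemiRingType.

Definition b_complete_semimodule (V : lSemiModType K) : Prop :=
  [/\ b_complete_semigroup V,
      forall (k : K) (S : set V) (s : V),
        is_sum S s -> is_sum [set k *: x | x in S] (k *: s)
    & forall (v : V) (Q : set K) (q : K),
        is_sum Q q -> is_sum [set k *: v | k in Q] (q *: v)].

Definition b_linear (V W : lSemiModType K) (g : V -> W) : Prop :=
  [/\ {morph g : x y / x + y},
      scalable g
    & forall (S : set V) (s : V), is_sum S s -> is_sum (g @` S) (g s)].

(* L_b(V, W), as a subset of the functions V -> W with pointwise addition. *)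
Definition b_linear_maps (V W : lSemiModType K) : set (V -> W) :=
  [set g | b_linear g].

(* K^o is K as a left semimodule over itself. *)
Definition one_dimensional (V W : lSemiModType K) (g : V -> W) : Prop :=
  exists (phi : V -> K^o) (w : W),
    b_linear phi /\ (forall v, g v = (phi v : K) *: w).

Definition b_nuclear (V W : lSemiModType K) (g : V -> W) : Prop :=
  exists G : set (V -> W),
    (forall h, G h -> one_dimensional h) /\ is_sum_in (@b_linear_maps V W) G g.

Definition b_nuclear_semimodule (V : lSemiModType K) : Prop :=
  forall W : lSemiModType K, b_complete_semimodule W ->
  forall g : V -> W, b_linear g -> b_nuclear g.

End Semimodules.

(* K(X).  An alias is used because the library equips X -> K with a scalar
   multiplication only when K is a ring. *)
Definition Kfun (X : Type) (K : pzSemiRingType) : Type := X -> K.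

Section KfunSemimodule.
Variables (X : Type) (K : pzSemiRingType).

HB.instance Definition _ := GRing.Nmodule.copy (Kfun X K) (X -> K).

Definition Kfun_scale (k : K) (f : Kfun X K) : Kfun X K := fun x => k * f x.

Lemma Kfun_scalerA a b v : Kfun_scale a (Kfun_scale b v) = Kfun_scale (a * b) v.
Proof. by apply/funext => x; exact: mulrA. Qed.

Lemma Kfun_scale0r v : Kfun_scale 0 v = 0.
Proof. by apply/funext => x; exact: mul0r. Qed.

Lemma Kfun_scale1r : left_id 1 Kfun_scale.
Proof. by move=> v; apply/funext => x; exact: mul1r. Qed.

Lemma Kfun_scalerDr : right_distributive Kfun_scale +%R.
Proof. by move=> a u v; apply/funext => x; exact: mulrDr. Qed.

Lemma Kfun_scalerDl v : {morph Kfun_scale^~ v : a b / a + b}.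
Proof. by move=> a b; apply/funext => x; exact: mulrDl. Qed.

HB.instance Definition _ := GRing.Nmodule_isLSemiModule.Build K (Kfun X K)
  Kfun_scalerA Kfun_scale0r Kfun_scale1r Kfun_scalerDr Kfun_scalerDl.

End KfunSemimodule.

Section FunctionalSemimodules.
Variables (K : pzSemiRingType) (X : Type).

(* A subLSemiModType is a subset S of K(X), packed as a type, whose inclusion
   val preserves 0, addition and scalar multiplication. *)
Definition functional_b_semimodule (S : pred (Kfun X K))
    (U : subLSemiModType S) : Prop :=
  b_complete_semimodule U /\ b_linear (val : U -> Kfun X K).

Definition kernel_theorem (S : pred (Kfun X K)) (U : subLSemiModType S) : Prop :=
  forall W : lSemiModType K, b_complete_semimodule W ->
  forall A : U -> W, b_linear A ->
  exists k : X -> W, forall f : U,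
    is_sum (range (fun x : X => (val f : Kfun X K) x *: k x)) (A f).

End FunctionalSemimodules.

(* Main.v *)
(* Sums in L_b(V, W) are pointwise, so the identity of V is b-nuclear iff there
   is a family of pairs (phi, w), phi a b-linear functional and w in V, with
   v = sum of the phi(v) w for every v.  A b-linear map g out of V carries this
   decomposition to g v = sum of the phi(v) g(w), hence is b-nuclear.  On the
   functional side the index set X is the set of all pairs (phi, w) with
   phi(v) w <= v for all v, which is never empty as it contains (0, 0): v is
   identified with the function (phi, w) |-> phi(v), and (phi, w) |-> A w is a
   kernel of A.  Conversely a kernel k of the inverse of V ~ U decomposes the
   identity of V, the functionals being the evaluations at the points of X. *)
From HB Require Import structures.
Require Import Defs.

Set Implicit Arguments.
Unset Strict Implicit.
Unset Printing Implicit Defensive.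

Local Open Scope ring_scope.
Local Open Scope classical_set_scope.

(** * Sums as least upper bounds in the standard order *)

Section StandardOrderTheory.
Variable T : nmodType.
Implicit Types (x y z s t : T) (A : set T).

Lemma idem_le_trans y x z : idem_le x y -> idem_le y z -> idem_le x z.
Proof. by rewrite /idem_le => xy <-; rewrite addrA xy. Qed.

Lemma idem_le_anti x y : idem_le x y -> idem_le y x -> x = y.
Proof. by rewrite /idem_le => xy <-; rewrite addrC. Qed.

Lemma is_sum_ub A s x : is_sum A s -> A x -> idem_le x s.
Proof. by case=> _ As _; exact: As. Qed.

Lemma is_sum_least A s t :
  is_sum A s -> (forall x, A x -> idem_le x t) -> idem_le s t.
Proof. by case=> _ _ lb At; exact: lb. Qed.

Lemma is_sumP A s : (forall x, A x -> idem_le x s) ->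
  (forall t, (forall x, A x -> idem_le x t) -> idem_le s t) -> is_sum A s.
Proof. by move=> As lb; split=> // t _; exact: lb. Qed.

Lemma is_sum_unique A s t : is_sum A s -> is_sum A t -> s = t.
Proof.
move=> As At; apply: idem_le_anti.
- by apply: (is_sum_least As) => x; exact: is_sum_ub.
- by apply: (is_sum_least At) => x; exact: is_sum_ub.
Qed.

Lemma is_sum_pair x y : (forall z, z + z = z) -> is_sum [set x; y] (x + y).
Proof.
move=> idem; apply: is_sumP => [_ [|] ->|t ub].
- by rewrite /idem_le addrA idem.
- by rewrite /idem_le addrCA idem.
- by rewrite /idem_le -addrA (ub y) ?(ub x) //; [left | right].
Qed.

End StandardOrderTheory.

Lemma additive_idem_le (T T' : nmodType) (f : T -> T') (x y : T) :
  {morph f : x y / x + y} -> idem_le x y -> idem_le (f x) (f y).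
Proof. by move=> fD xy; rewrite /idem_le -fD xy. Qed.

(** The inverse of an additive bijection is additive, so both directions are monotone: [f] is an
    order isomorphism and carries suprema to suprema. *)
Lemma is_sum_iso (T T' : nmodType) (f : T -> T') (g : T' -> T)
    (A : set T) (s : T) :
  cancel f g -> cancel g f -> {morph f : x y / x + y} ->
  is_sum A s -> is_sum (f @` A) (f s).
Proof.
move=> fK gK fD As.
have gD : {morph g : x y / x + y}.
  by move=> x y; apply: (can_inj fK); rewrite fD !gK.
apply: is_sumP => [_ [x Ax <-]|t ub].
  by apply: additive_idem_le => //; exact: is_sum_ub Ax.
rewrite -[t]gK; apply: additive_idem_le => //.
apply: (is_sum_least As) => x Ax; rewrite -[x]fK.
by apply: additive_idem_le => //; apply: ub; exists x.
Qed.

(** From left to right, [s] bounds [A] at each point, so b-completeness of [K] provides a pointwise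
    sum [t]. It lies below [s], and it bounds [A] in K(X), so [s] lies below it as well. *)
Lemma is_sum_Kfun (X : Type) (K : pzSemiRingType) (A : set (Kfun X K))
    (s : Kfun X K) : b_complete_semigroup K ->
  is_sum A s <-> forall x, is_sum [set f x | f in A] (s x).
Proof.
move=> [_ Kcomplete].
have leP (f g : Kfun X K) : idem_le f g <-> forall x, idem_le (f x) (g x).
  split=> [fg x|fg]; last by apply/funext => x; exact: fg.
  by rewrite /idem_le -[in RHS]fg.
split=> [As x|As].
  have /choice[t At] y : exists t, is_sum [set f y | f in A] t.
    apply: Kcomplete; exists (s y) => _ [f Af <-].
    by have /leP := is_sum_ub As Af; apply.
  suff <- : t = s by [].
  apply/funext => y; apply: idem_le_anti.
    apply: (is_sum_least (At y)) => _ [f Af <-].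
    by have /leP := is_sum_ub As Af; apply.
  have : idem_le s (t : Kfun X K).
    apply: (is_sum_least As) => f Af; apply/leP => z.
    by apply: (is_sum_ub (At z)); exists f.
  by move=> /leP; apply.
apply: is_sumP => [f Af|t ub]; apply/leP => x.
  by apply: (is_sum_ub (As x)); exists f.
apply: (is_sum_least (As x)) => _ [f Af <-].
by move/leP: (ub f Af); apply.
Qed.

(** * b-linear maps, their pointwise sums, and b-nuclear maps *)

Section BLinear.
Variable K : pzSemiRingType.
Implicit Types U V W : lSemiModType K.

Lemma b_linear_comp U V W (f : U -> V) (g : V -> W) :
  b_linear f -> b_linear g -> b_linear (g \o f).
Proof.
move=> [fD fZ fS] [gD gZ gS]; split=> [x y|k x|S s Ss] /=.
- by rewrite fD gD.
- by rewrite fZ gZ.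
- by have := gS _ _ (fS _ _ Ss); rewrite image_comp.
Qed.

Lemma b_linear_id V : b_linear (idfun : V -> V).
Proof. by split=> // S s; rewrite image_id. Qed.

Lemma b_linear_iso U V (f : U -> V) (g : V -> U) :
  cancel f g -> cancel g f -> {morph f : x y / x + y} -> scalable f ->
  b_linear f.
Proof. by move=> fK gK fD fZ; split=> // S s; exact: (is_sum_iso fK gK). Qed.

Lemma b_linear_inv U V (f : U -> V) (g : V -> U) :
  b_linear f -> cancel f g -> cancel g f -> b_linear g.
Proof.
move=> [fD fZ _] fK gK; apply: (b_linear_iso gK fK) => [x y|k x].
- by apply: (can_inj fK); rewrite fD !gK.
- by apply: (can_inj fK); rewrite fZ !gK.
Qed.

Definition rank_one V W (p : (V -> K^o) * W) (v : V) : W := (p.1 v : K) *: p.2.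

Lemma b_linear_rank_one V W (p : (V -> K^o) * W) :
  b_complete_semimodule W -> b_linear p.1 -> b_linear (rank_one p).
Proof.
case: p => phi w [_ _ Wr] /= [phiD phiZ phiS].
split=> [x y|k x|S s Ss]; rewrite /rank_one /=.
- by rewrite phiD scalerDl.
- by rewrite phiZ scalerA.
- by have := Wr w _ _ (phiS _ _ Ss); rewrite image_comp.
Qed.

Lemma b_linear_cst0 V W : b_complete_semigroup W ->
  b_linear (fun _ : V => 0 : W).
Proof.
move=> [idem _]; split=> [x y|k x|S s Ss]; rewrite ?addr0 ?scaler0 //.
by apply: is_sumP => [_ [x _ <-]|t _]; rewrite /idem_le add0r.
Qed.

Lemma one_dimensional_b_linear V W (g : V -> W) :
  b_complete_semimodule W -> one_dimensional g -> b_linear g.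
Proof.
move=> Wc [phi [w [phiL /funext ->]]].
exact: (@b_linear_rank_one _ _ (phi, w)).
Qed.

(** Preservation of sums is the interchange of two suprema, over [G] and over [S]; homogeneity holds
    because the action of a scalar on [W] preserves sums. *)
Lemma b_linear_pointwise_sum V W (G : set (V -> W)) (h : V -> W) :
  b_complete_semigroup V -> b_complete_semimodule W ->
  (forall g, G g -> b_linear g) ->
  (forall v, is_sum [set g v | g in G] (h v)) -> b_linear h.
Proof.
move=> [Videm _] [[Widem _] Wl _] GL Gh.
have hS S s : is_sum S s -> is_sum (h @` S) (h s).
  move=> Ss; apply: is_sumP => [_ [x Sx <-]|t ub].
    apply: (is_sum_least (Gh x)) => _ [g Gg <-].
    have [gD _ _] := GL g Gg.
    apply: (@idem_le_trans _ (g s)).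
      by apply: additive_idem_le => //; exact: is_sum_ub Sx.
    by apply: (is_sum_ub (Gh s)); exists g.
  apply: (is_sum_least (Gh s)) => _ [g Gg <-].
  have [_ _ gS] := GL g Gg.
  apply: (is_sum_least (gS _ _ Ss)) => _ [x Sx <-].
  apply: (@idem_le_trans _ (h x)); last by apply: ub; exists x.
  by apply: (is_sum_ub (Gh x)); exists g.
split=> // [x y|k x].
(* Additivity is preservation of the sum of the two-element set of [x] and [y]. *)
- apply: (is_sum_unique (hS _ _ (is_sum_pair x y Videm))).
  by rewrite image_setU !image_set1; exact: is_sum_pair.
- apply: (is_sum_unique (Gh _)).
  rewrite (_ : [set _ | _ in _] = [set k *: w | w in [set g x | g in G]]).
    exact: Wl.
  rewrite image_comp; apply: eq_imagel => g Gg /=.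
  by have [_ gZ _] := GL g Gg; exact: gZ.
Qed.

(* The pointwise sum of a bounded set of b-linear maps is itself b-linear, so
   sums in L_b(V, W) are pointwise. *)
Lemma is_sum_in_b_linear_maps V W (G : set (V -> W)) (g : V -> W) :
  b_complete_semigroup V -> b_complete_semimodule W ->
  (forall h, G h -> b_linear h) ->
  is_sum_in (@b_linear_maps K V W) G g <->
  b_linear g /\ forall v, is_sum [set h v | h in G] (g v).
Proof.
move=> Vc Wc GL; split=> [[gL ub lb]|[gL Gg]]; last first.
  split=> // [h Gh|t tL ub]; apply/funext => v.
    by apply: (is_sum_ub (Gg v)); exists h.
  apply: (is_sum_least (Gg v)) => _ [h Gh <-].
  by rewrite /idem_le -[in RHS](ub h Gh).
split=> // v; have [[_ Wcomplete] _ _] := Wc.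
have ubv u h : G h -> idem_le (h u) (g u).
  by move=> Gh; rewrite /idem_le -[in RHS](ub h Gh).
have /choice[t Gt] u : exists t, is_sum [set h u | h in G] t.
  by apply: Wcomplete; exists (g u) => _ [h Gh <-]; exact: ubv.
suff <- : t v = g v by [].
apply: idem_le_anti.
  by apply: (is_sum_least (Gt v)) => _ [h Gh <-]; exact: ubv.
have tL : b_linear t by exact: (b_linear_pointwise_sum Vc Wc GL Gt).
rewrite /idem_le -[in RHS](lb t tL) // => h Gh; apply/funext => u.
by apply: (is_sum_ub (Gt u)); exists h.
Qed.

(** Since sums in L_b(V, W) are pointwise, a set of one-dimensional maps can be traded for a set of
    pairs (phi, w), the form in which the decomposition is used below. *)
Lemma b_nuclearP V W (g : V -> W) :
  b_complete_semigroup V -> b_complete_semimodule W ->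
  b_nuclear g <-> b_linear g /\ exists P : set ((V -> K^o) * W),
    (forall p, P p -> b_linear p.1) /\
    forall v, is_sum [set rank_one p v | p in P] (g v).
Proof.
move=> Vc Wc; split=> [[G [G1 Gg]]|[gL [P [PL Pg]]]].
  have GL h : G h -> b_linear h.
    by move/G1; exact: one_dimensional_b_linear.
  have [gL gS] := (is_sum_in_b_linear_maps g Vc Wc GL).1 Gg.
  (* Taking all pairs that represent a member of [G] avoids choosing one for each map. *)
  split=> //; exists [set p | b_linear p.1 /\ G (rank_one p)].
  split=> [p []//|v].
  rewrite (_ : [set _ | _ in _] = [set h v | h in G]) //.
  apply/seteqP; split=> [_ [p [_ Gp] <-]|_ [h Gh <-]].
    by exists (rank_one p).
  have [phi [w [phiL hE]]] := G1 h Gh.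
  exists (phi, w); last by rewrite hE.
  by split=> //; rewrite (_ : rank_one _ = h) //; apply/funext => u; rewrite hE.
have G1 h : (@rank_one V W @` P) h -> one_dimensional h.
  by move=> [p Pp <-]; exists p.1, p.2; split=> //; exact: PL.
exists (@rank_one V W @` P); split=> //; apply/is_sum_in_b_linear_maps => //.
  by move=> h /G1; exact: one_dimensional_b_linear.
by split=> // v; rewrite image_comp; exact: Pg.
Qed.

End BLinear.

(* A semimodule with an injective linear map i into K(X), viewed as the
   functional semimodule i(V) with i as its inclusion. *)
Section LinearEmbedding.
Variables (K : pzSemiRingType) (V : lSemiModType K) (X : Type).
Variables (i : {linear V -> Kfun X K}).

Definition in_range : pred (Kfun X K) := fun f => `[< range i f >].

(** The proof of injectivity is a parameter of the type so that the subtype structure, whose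
    induction principle rests on it, can be attached to the type. *)
Definition embedded (_ : injective i) : Type := V.

Variable i_inj : injective i.
Local Notation U := (embedded i_inj).

HB.instance Definition _ := GRing.LSemiModule.on U.

Definition embedded_val (u : U) : Kfun X K := i u.

Definition embedded_Sub f (fP : in_range f) : U :=
  sval (cid2 (asboolW fP)).

Lemma embedded_SubK f fP : embedded_val (@embedded_Sub f fP) = f.
Proof. by rewrite /embedded_val /embedded_Sub; case: cid2. Qed.

Lemma embedded_Sub_rect (P : U -> Type) :
  (forall f fP, P (@embedded_Sub f fP)) -> forall u, P u.
Proof.
move=> PS u; have uP : in_range (i u) by apply/asboolP; exists u.
have := PS _ uP; rewrite (_ : embedded_Sub uP = u) //.
by apply: i_inj; exact: embedded_SubK.
Qed.

HB.instance Definition _ := isSub.Build (Kfun X K) in_range U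
  embedded_Sub_rect embedded_SubK.

Lemma embedded_val_nmod : nmod_morphism (val : U -> Kfun X K).
Proof. by split; [exact: (raddf0 i) | exact: (raddfD i)]. Qed.

HB.instance Definition _ := GRing.isSubBaseAddUMagma.Build (Kfun X K) in_range U
  embedded_val_nmod.

Lemma embedded_valZ : scalable (val : U -> Kfun X K).
Proof. exact: (linearZ_LR i). Qed.

HB.instance Definition _ := GRing.isSubLSemiModule.Build K (Kfun X K) in_range U
  embedded_valZ.

End LinearEmbedding.

(** * Nuclearity of the identity and functional realizations *)

Section NuclearEmbedding.
Variables (K : pzSemiRingType) (V : lSemiModType K).
Hypothesis hK : b_complete_semiring K.
Hypothesis hV : b_complete_semimodule V.

Lemma functional_b_nuclear (X : Type) (S : pred (Kfun X K))
    (U : subLSemiModType S) (h : {linear V -> U}) :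
  functional_b_semimodule U -> kernel_theorem U -> bijective h ->
  b_nuclear (idfun : V -> V).
Proof.
have [Kc _ _] := hK; have [Vc _ _] := hV.
move=> [_ valL] ker [g hK' gK].
have hL : b_linear h.
  by apply: (b_linear_iso hK' gK); [exact: raddfD | exact: linearZ_LR].
have gL : b_linear g by exact: (b_linear_inv hL hK' gK).
have [k kP] := ker V hV g gL.
pose phi x : V -> K^o := fun v => (val (h v) : Kfun X K) x.
have phiL x : b_linear (phi x).
  have [cD cZ cS] := b_linear_comp hL valL.
  split=> [u v|a v|A s As]; rewrite /phi.
  - exact: (congr1 (@^~ x) (cD u v)).
  - exact: (congr1 (@^~ x) (cZ a v)).
  - by have := (is_sum_Kfun _ _ Kc).1 (cS _ _ As) x; rewrite image_comp.
apply/b_nuclearP => //; split; first exact: b_linear_id.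
exists (range (fun x => (phi x, k x))); split=> [_ [x _ <-]|v].
  exact: phiL.
by have := kP (h v); rewrite hK' image_comp.
Qed.

Lemma b_nuclear_functional : b_nuclear (idfun : V -> V) ->
  exists (X : Type) (S : pred (Kfun X K)) (U : subLSemiModType S),
    [/\ inhabited X, functional_b_semimodule U, kernel_theorem U
      & exists h : {linear V -> U}, bijective h].
Proof.
have [Kc _ _] := hK; have [Vc _ _] := hV.
move=> /(b_nuclearP _ Vc hV)[_ [P [PL Pid]]].
pose Q : set ((V -> K^o) * V) :=
  [set p | b_linear p.1 /\ forall v, idem_le (rank_one p v) v].
(* Enlarging [P] to [Q] keeps the sum: every new term is still below [v], and the terms from [P]
   already force any upper bound above [v]. *)
have Qid v : is_sum [set rank_one p v | p in Q] v.
  apply: is_sumP => [_ [p [_ pv] <-]//|t ub].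
  apply: (is_sum_least (Pid v)) => _ [p Pp <-].
  apply: ub; exists p => //; split=> [|u]; first exact: PL.
  by apply: (is_sum_ub (Pid u)); exists p.
pose X := {p | Q p}.
pose i (v : V) : Kfun X K := fun x => (sval x).1 v.
have iP : semilinear_for *:%R i.
  split=> [a v|u v]; apply/funext => -[p Qp]; have [[pD pZ _] _] := Qp.
  - exact: pZ.
  - exact: pD.
pose iL := GRing.isSemilinear.Build _ _ _ *:%R i iP.
pose j : {linear V -> Kfun X K} := HB.pack i iL.
(* The values phi(v) determine all terms phi(v) w of the decomposition, hence their sum [v]. *)
have j_inj : injective j.
  move=> u v uv; apply: (is_sum_unique (Qid u)).
  rewrite (_ : [set _ | _ in _] = [set rank_one p v | p in Q]) //.
  apply: eq_imagel => p Qp.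
  by have /= := congr1 (@^~ (exist _ p Qp)) uv; rewrite /i /rank_one /= => ->.
exists X, (in_range j), (embedded j_inj); split.
- constructor; exists (fun=> 0, 0); split=> [|v] /=.
    exact: b_linear_cst0.
  by rewrite /rank_one /idem_le scaler0 add0r.
(* The type [embedded j_inj] is [V] with its own operations, so completeness is inherited verbatim;
   the inclusion [j] is b-linear because each coordinate is. *)
- split; first exact: hV.
  split; [exact: raddfD | exact: linearZ_LR | move=> S s Ss].
  apply/is_sum_Kfun => // -[p Qp]; rewrite image_comp.
  by have [[_ _ pS] _] := Qp; exact: pS.
- move=> W Wc A [AD AZ AS]; exists (fun x => A (sval x).2) => v.
  have := AS _ _ (Qid v); rewrite image_comp.
  congr is_sum; apply/seteqP; split=> [_ [p Qp <-]|_ [[p Qp] _ <-]] /=.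
    by exists (exist _ p Qp) => //=; rewrite /rank_one AZ.
  by exists p => //; rewrite /rank_one /= AZ.
- by exists idfun; exists idfun.
Qed.

Lemma b_nuclear_idP : b_nuclear (idfun : V -> V) <-> b_nuclear_semimodule V.
Proof.
have [Vc _ _] := hV.
split=> [/(b_nuclearP _ Vc hV)[_ [P [PL Pid]]] W Wc g gL|]; last first.
  by apply; [exact: hV | exact: b_linear_id].
apply/b_nuclearP => //; split=> //; have [_ gZ gS] := gL.
exists [set (p.1, g p.2) | p in P]; split=> [_ [p Pp <-]|v]; first exact: PL.
have := gS _ _ (Pid v); rewrite !image_comp; congr is_sum.
by apply: eq_imagel => p _; exact: gZ.
Qed.

End NuclearEmbedding.

Theorem theorem5 (K : pzSemiRingType) (V : lSemiModType K)
    (hK : b_complete_semiring K) (hV : b_complete_semimodule V) :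
  ((exists (X : Type) (S : pred (Kfun X K)) (U : subLSemiModType S),
      [/\ inhabited X, functional_b_semimodule U, kernel_theorem U
        & exists h : {linear V -> U}, bijective h])
   <-> b_nuclear (idfun : V -> V))
  /\ (b_nuclear (idfun : V -> V) <-> b_nuclear_semimodule V).
Proof.
split; last exact: b_nuclear_idP.
split; last exact: b_nuclear_functional.
by move=> [X [S [U [_ Uf Uk [h hbij]]]]]; exact: functional_b_nuclear hbij.
Qed.
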